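(* Fix positive integers $\beta,p$. There is an algorithm which, given $n$ and an integer $m\in\{1,\ldots,M_n\}$ where $M_n=|\mathcal{S}_n(\beta,p)|$, outputs the vector $\mathbf{c}\in\mathcal{S}_n(\beta,p)$ with $ord(\mathbf{c})=m$; its time complexity and space complexity are both $O(n)$.
   Context: A binary vector is $(\beta,p)$-window-weight-limited (WWL) if every $\beta$ consecutive entries contain at most $p$ ones; $\mathcal{S}_n(\beta,p)$ is the set of $(\beta,p)$-WWL vectors of length $n$. For $\mathbf{x}=(x_1,\ldots,x_n)\in\{0,1\}^n$ let $\psi(\mathbf{x})=\sum_{k=1}^n x_k2^{n-k}$ (so $x_1$ is the most significant bit), and write $\mathbf{x}\preceq\mathbf{y}$ iff $\psi(\mathbf{x})\le\psi(\mathbf{y})$. For a set $X$ of distinct binary vectors of length $n$ and $\mathbf{x}\in X$, $ord(\mathbf{x})=|\{\mathbf{y}\in X:\mathbf{y}\preceq\mathbf{x}\}|$. Complexity is measured with $\beta,p$ fixed, counting arithmetic operations and storage of integers at unit cost. *)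

(* Defs.v *)
From mathcomp Require Import all_boot.
Set Implicit Arguments. Unset Strict Implicit. Unset Printing Implicit Defensive.

Definition wwl (beta p n : nat) (x : n.-tuple bool) : bool :=
  [forall i : 'I_n.+1, (i + beta <= n) ==>
     (\sum_(i <= j < i + beta) nth false x j <= p)].

Definition Sn (beta p n : nat) : {set n.-tuple bool} := [set x | wwl beta p x].

Definition Mn (beta p n : nat) : nat := #|Sn beta p n|.

(* psi(x) = sum_{k=1}^n x_k 2^{n-k}; with 0-based index k this is 2^(n-1-k). *)
Definition psi (n : nat) (x : n.-tuple bool) : nat :=
  \sum_(k < n) nat_of_bool (tnth x k) * 2 ^ (n - k.+1).

Definition ord (beta p n : nat) (x : n.-tuple bool) : nat :=
  #|[set y in Sn beta p n | psi y <= psi x]|.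

(* Memory cells hold natural numbers of unbounded size; each instruction costs
   one unit of time; space = number of memory cells used (high-water mark:
   1 + largest address ever accessed). *)

Inductive binop := OAdd | OSub | OMul | ODiv | OMod | OLt | OEq.

Definition eval_binop (o : binop) (x y : nat) : nat :=
  match o with
  | OAdd => x + y
  | OSub => x - y
  | OMul => x * y
  | ODiv => x %/ y
  | OMod => x %% y
  | OLt => nat_of_bool (x < y)
  | OEq => nat_of_bool (x == y)
  end.

Inductive instr :=
| IConst (d c : nat)
| IBin (o : binop) (d a b : nat)
| ILoad (d a : nat)
| IStore (a s : nat)
| IJz (a t : nat)
| IJmp (t : nat)
| IHalt.

Record state := mkState { pc : nat; rmem : nat -> nat; hw : nat }.

Definition upd (m : nat -> nat) (a v : nat) : nat -> nat :=
  fun x => if x == a then v else m x.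

(* One step; None when the machine has halted (IHalt, or pc outside program). *)
Definition step (P : seq instr) (s : state) : option state :=
  let m := rmem s in
  match nth IHalt P (pc s) with
  | IHalt => None
  | IConst d c => Some (mkState (pc s).+1 (upd m d c) (maxn (hw s) d.+1))
  | IBin o d a b =>
      Some (mkState (pc s).+1 (upd m d (eval_binop o (m a) (m b)))
                    (maxn (hw s) (maxn d (maxn a b)).+1))
  | ILoad d a =>
      Some (mkState (pc s).+1 (upd m d (m (m a)))
                    (maxn (hw s) (maxn d (maxn a (m a))).+1))
  | IStore a s' =>
      Some (mkState (pc s).+1 (upd m (m a) (m s'))
                    (maxn (hw s) (maxn s' (maxn a (m a))).+1))
  | IJz a t => Some (mkState (if m a == 0 then t else (pc s).+1) m (maxn (hw s) a.+1))
  | IJmp t => Some (mkState t m (hw s))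
  end.

Fixpoint exec (P : seq instr) (k : nat) (s : state) : option state :=
  match k with
  | 0 => Some s
  | k'.+1 => match step P s with
             | None => None
             | Some s' => exec P k' s'
             end
  end.

Definition halts_in (P : seq instr) (s0 : state) (t : nat) (sf : state) : Prop :=
  exec P t s0 = Some sf /\ step P sf = None.

Definition init_state (n m : nat) : state :=
  mkState 0 (fun x => if x == 0 then n else if x == 1 then m else 0) 2.

(* Main.v *)
Require Import Defs.
From mathcomp Require Import all_boot.
From mathcomp Require Import zify.
Set Implicit Arguments. Unset Strict Implicit. Unset Printing Implicit Defensive.

(* Whether a word is WWL is decided by an automaton remembering the last beta
   bits.  A table of the numbers of accepted completions of length k from each
   history satisfies a two-term recurrence and has O(n) entries; the word of rank
   r is then read off greedily from the most significant bit: put 0 if r is less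
   than the number a of completions after a 0, otherwise put 1 and subtract a
   from r.  The RAM program consists of straight-line blocks and two countdown
   loops, so its running time is a sum of block lengths and iteration counts. *)

(** * Counting and unranking *)

Fixpoint popcount (d w : nat) : nat :=
  if d is d'.+1 then w %% 2 + popcount d' (w %/ 2) else 0.

(* The history is the word of the last beta bits, read as a number below
   W = 2 ^ beta; [push] appends a bit and forgets the oldest one. *)
Definition push (W w : nat) (b : bool) : nat := (w + w) %% W + b.

Section Automaton.

Variables (beta q : nat).
Let W := 2 ^ beta.

Definition light (w : nat) : bool := popcount beta w < q.

Fixpoint accepts (w : nat) (s : seq bool) : bool :=
  light w && (if s is b :: s' then accepts (push W w b) s' else true).

Fixpoint completions (k w : nat) : nat :=
  if k is k'.+1 then
    light w * (completions k' (push W w false) + completions k' (push W w true))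
  else light w.

Fixpoint unrank (k w r : nat) : seq bool :=
  if k is k'.+1 then
    let a := completions k' (push W w false) in
    let b := a <= r in
    b :: unrank k' (push W w b) (r - a * b)
  else [::].

Lemma size_unrank k w r : size (unrank k w r) = k.
Proof. by elim: k w r => //= k IHk w r; rewrite IHk. Qed.

Lemma sum_tuple_cons k (F : seq bool -> nat) :
  \sum_(y : k.+1.-tuple bool) F y =
  \sum_(y : k.-tuple bool) F (false :: y) + \sum_(y : k.-tuple bool) F (true :: y).
Proof.
transitivity (\sum_(b : bool) \sum_(y : k.-tuple bool) F (b :: y)); last by rewrite big_bool addnC.
rewrite pair_big (reindex (fun by_ : bool * k.-tuple bool => [tuple of by_.1 :: by_.2])) //=.
exists (fun y : k.+1.-tuple bool => (thead y, [tuple of behead y])).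
  by case=> b y _ /=; congr pair; apply/val_inj.
by move=> y _ /=; rewrite -tuple_eta.
Qed.

Lemma completionsE k w : completions k w = \sum_(y : k.-tuple bool) accepts w y.
Proof.
elim: k w => [|k IHk] w /=.
  rewrite (eq_bigr (fun _ => light w : nat)).
    by rewrite sum_nat_const card_tuple expn0 mul1n.
  by move=> y _; rewrite tuple0 /= andbT.
rewrite (@sum_tuple_cons k (fun y => accepts w y)) !IHk mulnDr !big_distrr /=.
by congr (_ + _); apply: eq_bigr => y _; rewrite mulnb.
Qed.

End Automaton.

Fixpoint seq_psi (s : seq bool) : nat :=
  if s is b :: s' then b * 2 ^ size s' + seq_psi s' else 0.

Lemma seq_psi_lt s : seq_psi s < 2 ^ size s.
Proof. elim: s => //= b s IHs; rewrite expnS; case: b; lia. Qed.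

Lemma psiE n (x : n.-tuple bool) : psi x = seq_psi x.
Proof.
rewrite /psi.
have -> : \sum_(k < n) tnth x k * 2 ^ (n - k.+1) =
          \sum_(k < n) nth false x k * 2 ^ (n - k.+1).
  by apply: eq_bigr => i _; rewrite (tnth_nth false).
case: x => s /= /eqP <-; elim: s => [|b s IHs] /=; first by rewrite big_ord0.
by rewrite big_ord_recl /= subSS subn0 -IHs.
Qed.

(** Ranks are zero-based here, hence [r.+1]. A word of length k has value below 2^k, so if the
    output starts with 1 all a accepted words starting with 0 precede it, and if it starts with 0 no
    word starting with 1 does. *)
Lemma unrank_spec beta q k w r : r < completions beta q k w ->
  accepts beta q w (unrank beta q k w r) /\
  \sum_(y : k.-tuple bool)
     (accepts beta q w y && (seq_psi y <= seq_psi (unrank beta q k w r))) = r.+1.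
Proof.
elim: k w r => [|k IHk] w r /=.
  case Hl: (light beta q w) => //= ; case: r => // _; split=> //.
  rewrite (eq_bigr (fun _ => 1)); first by rewrite sum_nat_const card_tuple.
  by move=> y _; rewrite tuple0 /= Hl.
case Hl: (light beta q w) => /=; last by rewrite mul0n.
rewrite mul1n => Hr.
set z := (_ * _ + seq_psi _).
rewrite (@sum_tuple_cons k (fun y => accepts beta q w y && (seq_psi y <= z))) {}/z /= Hl /=.
set a := completions _ _ _ (push _ w false) in Hr *.
rewrite size_unrank.
case: (leqP a r) => Har /=.
  rewrite muln1.
  have [|-> IH2] := IHk (push (2 ^ beta) w true) (r - a); first by lia.
  split=> //.
  rewrite (eq_bigr (fun y : k.-tuple bool => nat_of_bool (accepts beta q (push (2 ^ beta) w false) y))); last first.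
    move=> y _; have := seq_psi_lt y; rewrite size_tuple => Hy.
    by case: accepts => //=; rewrite mul0n mul1n; apply/eqP; rewrite eqb1; lia.
  rewrite -completionsE -/a.
  under eq_bigr => y _ do rewrite size_tuple leq_add2l.
  by rewrite IH2; lia.
rewrite muln0 subn0.
have [//|-> IH2] := IHk (push (2 ^ beta) w false) r.
split=> //.
rewrite [X in _ + X]big1 => [|y _]; last first.
  set s := unrank _ _ _ _ _; have := seq_psi_lt s; rewrite size_unrank size_tuple => Hs.
  by apply/eqP; rewrite eqb0 negb_and -ltnNge; apply/orP; right; lia.
by rewrite addn0.
Qed.

(** * Histories, windows and the WWL condition *)

Definition num_of (s : seq bool) : nat := foldl (fun w (b : bool) => w + w + b) 0 s.

Lemma popcount_mod d w : popcount d (w %% 2 ^ d) = popcount d w.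
Proof.
elim: d w => //= d IHd w.
rewrite -(IHd (w %/ 2)) expnS modn_dvdm ?dvdn_mulr //.
congr (_ + popcount _ _).
by rewrite modn_divl mulnC.
Qed.

(** The low-order bits are the most recent ones, hence the reversal. *)
Lemma popcount_num_of d s : popcount d (num_of s) = sumn (take d (map nat_of_bool (rev s))).
Proof.
elim/last_ind: s d => [|s b IHs] [|d] //=.
- by have -> : forall d, popcount d 0 = 0 by elim=> //= ? ->; rewrite div0n.
- by rewrite take0.
rewrite rev_rcons /= -IHs.
have -> : num_of (rcons s b) = num_of s * 2 + b by rewrite /num_of -cats1 foldl_cat /= addnn muln2.
by rewrite modnMDl divnMDl // [b %/ 2]divn_small ?addn0; case: b.
Qed.


(** As 2^beta is even, so is the residue of a double; it is at most 2^beta - 2, and adding a bit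
    needs no further reduction. *)
Lemma push_mod beta x (b : bool) : 0 < beta ->
  push (2 ^ beta) (x %% 2 ^ beta) b = (x + x + b) %% 2 ^ beta.
Proof.
case: beta => // d _; rewrite /push modnDm expnS.
set v := 2 ^ d; have v0 : 0 < v by rewrite expn_gt0.
have -> : (x + x) %% (2 * v) = 2 * (x %% v) by rewrite addnn -mul2n muln_modr.
have -> : x + x + b = x %/ v * (2 * v) + (2 * (x %% v) + b).
  by rewrite {1 2}(divn_eq x v) mulnCA; lia.
rewrite modnMDl [RHS]modn_small //.
have := ltn_pmod x v0; case: b; lia.
Qed.

Lemma push_lt beta w b : 0 < beta -> push (2 ^ beta) w b < 2 ^ beta.
Proof.
case: beta => // d _; rewrite /push addnn -mul2n expnS.
have v0 : 0 < 2 ^ d by rewrite expn_gt0.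
rewrite -muln_modr; have := ltn_pmod w v0; case: b; lia.
Qed.

Lemma foldl_push beta s : 0 < beta ->
  foldl (push (2 ^ beta)) 0 s = num_of s %% 2 ^ beta.
Proof.
move=> b0; elim/last_ind: s => [|s b IHs]; first by rewrite mod0n.
by rewrite /num_of -!cats1 !foldl_cat /= IHs push_mod.
Qed.

Lemma acceptsP beta q w s :
  reflect (forall i, i <= size s ->
             light beta q (foldl (push (2 ^ beta)) w (take i s)))
          (accepts beta q w s).
Proof.
elim: s w => [|b s IHs] w /=.
  by rewrite andbT; apply: (iffP idP) => [? i|/(_ 0)->].
apply: (iffP andP) => [[Hl /IHs H] [|i] //|H]; first by move/H.
split; first exact: (H 0).
by apply/IHs => i Hi; apply: (H i.+1).
Qed.

Lemma sumn_last d (s : seq bool) i : i <= size s ->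
  sumn (take d (map nat_of_bool (rev (take i s)))) = \sum_(i - d <= j < i) nth false s j.
Proof.
elim: i d => [|i IHi] d Hi; first by rewrite take0 big_geq.
case: d => [|d]; first by rewrite take0 subn0 big_geq.
rewrite (take_nth false) // rev_rcons /= IHi; last exact: ltnW.
by rewrite subSS big_nat_recr ?leq_subr //= addnC.
Qed.

(* Starting from the all-zero history also tests the windows sticking out to the
   left: harmless when beta <= n, since they lie in the first full window; when
   n < beta there is no constraint, whence the larger threshold. *)
Lemma accepts_wwl beta p n (x : n.-tuple bool) : 0 < beta ->
  accepts beta (p.+1 + (n < beta) * beta) 0 x = wwl beta p x.
Proof.
move=> b0; set q := _ + _.
have lightE i : i <= n -> light beta q (foldl (push (2 ^ beta)) 0 (take i x)) =
    (\sum_(i - beta <= j < i) nth false x j < q).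
  by move=> Hi; rewrite /light foldl_push // popcount_mod popcount_num_of sumn_last // size_tuple.
have sum_le a b : \sum_(a <= j < b) nth false x j <= b - a.
  by rewrite -[leqRHS]muln1 -sum_nat_const_nat leq_sum // => j _; case: nth.
apply/acceptsP/forallP => [H i|H i].
  apply/implyP => Hi; have := H (i + beta); rewrite size_tuple => /(_ Hi).
  rewrite lightE // addnK /q.
  by rewrite [n < beta]ltnNge (leq_trans (leq_addl _ _) Hi) addn0.
rewrite size_tuple => Hi; rewrite lightE // /q.
case: (ltnP n beta) => Hn; first by have := sum_le (i - beta) i; lia.
rewrite addn0 ltnS; case: (leqP beta i) => Hib.
  have Ho : i - beta < n.+1 by lia.
  by have := H (Ordinal Ho); rewrite /= subnK // Hi.
have := H ord0; rewrite /= add0n Hn /=; apply: leq_trans.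
have -> : i - beta = 0 by lia.
by rewrite [leqRHS](@big_cat_nat _ _ _ i) ?leq_addr // ltnW.
Qed.

Lemma unrank_ord beta p n m (q := p.+1 + (n < beta) * beta) :
  0 < beta -> 0 < m -> m <= Mn beta p n ->
  exists c : n.-tuple bool,
    [/\ c \in Sn beta p n, ord beta p c = m & tval c = unrank beta q n 0 m.-1].
Proof.
move=> b0 m0 Hm.
have Hr : m.-1 < completions beta q n 0.
  rewrite completionsE prednK // (leq_trans Hm) // /Mn /Sn -sum1dep_card big_mkcond /=.
  by apply: leq_sum => y _; rewrite accepts_wwl //; case: wwl.
have [Ha Hs] := unrank_spec Hr.
have Hsz : size (unrank beta q n 0 m.-1) == n by rewrite size_unrank.
exists (Tuple Hsz); split=> //; first by rewrite inE -accepts_wwl.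
rewrite /ord -sum1dep_card big_mkcond /= -[RHS](prednK m0) -Hs.
apply: eq_bigr => y _; rewrite inE -accepts_wwl // !psiE /=.
by case: (_ && _).
Qed.

(** * Symbolic execution of RAM programs *)

Definition memory := nat -> nat.

(** Rejecting jumps and halts forces straight-line code. Only direct addresses are bounded here;
    [wp] bounds the indirect ones. *)
Definition regs_below (K : nat) (i : instr) : bool :=
  match i with
  | IConst d _ => d < K
  | IBin _ d a b => [&& d < K, a < K & b < K]
  | ILoad d a => (d < K) && (a < K)
  | IStore a s => (a < K) && (s < K)
  | _ => false
  end.

(* Computed values are abstracted by equations, so that symbolic execution does
   not duplicate the memory term. *)
Fixpoint wp (B : nat) (c : seq instr) (Q : memory -> Prop) (m : memory) : Prop :=
  match c with
  | [::] => Q m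
  | IConst d v :: c' => wp B c' Q (upd m d v)
  | IBin o d a b :: c' =>
      forall v, v = eval_binop o (m a) (m b) -> wp B c' Q (upd m d v)
  | ILoad d a :: c' =>
      m a < B /\ forall v, v = m (m a) -> wp B c' Q (upd m d v)
  | IStore a s :: c' =>
      m a < B /\ forall x v, x = m a -> v = m s -> wp B c' Q (upd m x v)
  | _ => False
  end.

Lemma wp_cat B c1 c2 Q m : wp B c1 (wp B c2 Q) m -> wp B (c1 ++ c2) Q m.
Proof.
elim: c1 m => [|[d v|o d a b|d a|a s|a t|t|] c1 IH] m //=.
- exact: IH.
- by move=> H v Hv; apply: IH; apply: H.
- by case=> ? H; split=> // v Hv; apply: IH; apply: H.
- by case=> ? H; split=> // x v Hx Hv; apply: IH; apply: H.
Qed.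

Lemma wp_mono B c (Q Q' : memory -> Prop) m :
  (forall m', Q m' -> Q' m') -> wp B c Q m -> wp B c Q' m.
Proof.
move=> QQ'; elim: c m => [|[d v|o d a b|d a|a s|a t|t|] c IH] m //=; first exact: QQ'.
- exact: IH.
- by move=> H v Hv; apply: IH; apply: H.
- by case=> ? H; split=> // v Hv; apply: IH; apply: H.
- by case=> ? H; split=> // x v Hx Hv; apply: IH; apply: H.
Qed.

(** Quantifying over all marks up to a fixed B lets runs compose by adding times, with no exact
    space accounting. *)
Definition reaches (P : seq instr) (B t a : nat) (m : memory) (b : nat) (m' : memory) :=
  forall h, h <= B -> exists2 h', h' <= B &
    exec P t (mkState a m h) = Some (mkState b m' h').

Lemma exec_add P t1 t2 s s1 :
  exec P t1 s = Some s1 -> exec P (t1 + t2) s = exec P t2 s1.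
Proof.
elim: t1 s => [|t1 IH] s /=; first by case=> ->.
by case: (step P s) => // s' /IH.
Qed.

Lemma reaches_trans P B t1 t2 a b c m1 m2 m3 :
  reaches P B t1 a m1 b m2 -> reaches P B t2 b m2 c m3 ->
  reaches P B (t1 + t2) a m1 c m3.
Proof.
move=> H1 H2 h /H1[h1 /H2[h2 Hh2 E2] E1].
by exists h2 => //; rewrite (exec_add _ E1).
Qed.

Lemma reaches_step P B a m b m' :
  (forall h, h <= B -> exists2 h', h' <= B &
     step P (mkState a m h) = Some (mkState b m' h')) ->
  reaches P B 1 a m b m'.
Proof. by move=> H h /H[h' Hh' E]; exists h' => //=; rewrite E. Qed.

Lemma nth_mid (l r : seq instr) i : nth IHalt (l ++ i :: r) (size l) = i.
Proof. by rewrite nth_cat ltnn subnn. Qed.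

(** The induction moves each executed instruction from the block to the prefix [l], whose size is
    the program counter. *)
Lemma reaches_block B K l c r Q m : K <= B ->
  all (regs_below K) c -> wp B c Q m ->
  exists2 m', Q m' &
    reaches (l ++ c ++ r) B (size c) (size l) m (size l + size c) m'.
Proof.
move=> KB; elim: c l m => [|i c IH] l m /=.
  by move=> _ HQ; exists m => // h Hh; exists h; rewrite ?addn0.
case/andP=> Hi Hc Hwp.
suff [m1 Hwp1 H1] : exists2 m1, wp B c Q m1 &
    reaches (l ++ i :: c ++ r) B 1 (size l) m (size l).+1 m1.
  have [m2 HQ H2] := IH (rcons l i) m1 Hc Hwp1.
  exists m2 => //; rewrite -add1n; apply: reaches_trans H1 _.
  by move: H2; rewrite cat_rcons size_rcons addSnnS.
have E h : nth IHalt (l ++ i :: c ++ r) (pc (mkState (size l) m h)) = i by rewrite nth_mid.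
case: i Hi Hwp E => [d v|o d a b|d a|a s|a t|t|] //= Hi Hwp E.
- exists (upd m d v) => //; apply: reaches_step => h Hh.
  by rewrite /step nth_mid; eexists; last by []; rewrite geq_max Hh /=; lia.
- exists (upd m d (eval_binop o (m a) (m b))); first exact: Hwp.
  apply: reaches_step => h Hh.
  by rewrite /step nth_mid; eexists; last by []; move: Hi => /and3P[]; rewrite geq_max Hh /=; lia.
- case: Hwp => Ha Hwp; exists (upd m d (m (m a))); first exact: Hwp.
  apply: reaches_step => h Hh.
  by rewrite /step nth_mid; eexists; last by []; move: Hi => /andP[]; rewrite geq_max Hh /=; lia.
- case: Hwp => Ha Hwp; exists (upd m (m a) (m s)); first exact: Hwp.
  apply: reaches_step => h Hh.
  by rewrite /step nth_mid; eexists; last by []; move: Hi => /andP[]; rewrite geq_max Hh /=; lia.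
Qed.

Definition loop (o a : nat) (c : seq instr) : seq instr :=
  IJz a (o + (size c).+2) :: rcons c (IJmp o).

Lemma size_loop o a c : size (loop o a c) = (size c).+2.
Proof. by rewrite /= size_rcons. Qed.

(** The invariant is indexed by the iterations still to run. Each costs the body plus the test and
    the jump back; the last unit is the test that exits. *)
Lemma reaches_loop B K l a c r (Inv : nat -> memory -> Prop) N m :
  K <= B -> a < K -> all (regs_below K) c ->
  (forall i m, Inv i m -> m a = i) ->
  (forall i m, i < N -> Inv i.+1 m -> wp B c (Inv i) m) ->
  Inv N m ->
  exists2 m', Inv 0 m' &
    reaches (l ++ loop (size l) a c ++ r) B (N * (size c).+2).+1
      (size l) m (size l + size (loop (size l) a c)) m'.
Proof.
move=> KB aK Hc Hr Hstep; rewrite size_loop; set P := l ++ _.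
have E h m1 : step P (mkState (size l) m1 h) =
    Some (mkState (if m1 a == 0 then size l + (size c).+2 else (size l).+1) m1 (maxn h a.+1)).
  by rewrite /step /P /= nth_mid.
have hB h : h <= B -> maxn h a.+1 <= B by move=> Hh; rewrite geq_max Hh (leq_trans aK).
elim: N m Hstep => [|N IH] m Hstep Hm.
  exists m => //; apply: reaches_step => h Hh; exists (maxn h a.+1); first exact: hB.
  by rewrite E (Hr _ _ Hm).
have [m1 Hm1 R1] := @reaches_block B K (rcons l (IJz a (size l + (size c).+2))) c
  (IJmp (size l) :: r) _ m KB Hc (Hstep N m (ltnSn N) Hm).
have [|m2 Hm2 R2] := IH m1 _ Hm1.
  by move=> i m' Hi; apply: Hstep; apply: ltnW.
exists m2 => //.
have -> : (N.+1 * (size c).+2).+1 = 1 + (size c + (1 + (N * (size c).+2).+1)) by lia.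
have EP : rcons l (IJz a (size l + (size c).+2)) ++ c ++ IJmp (size l) :: r = P.
  by rewrite /P /loop /= !cat_rcons.
move: R1; rewrite EP size_rcons => R1.
apply: reaches_trans (reaches_trans R1 (reaches_trans _ R2)).
  apply: reaches_step => h Hh; exists (maxn h a.+1); first exact: hB.
  by rewrite E (Hr _ _ Hm).
apply: reaches_step => h Hh; exists h => //.
have -> : (size l).+1 + size c = size (l ++ IJz a (size l + (size c).+2) :: c).
  by rewrite size_cat /= addnS addSn.
have -> : P = (l ++ IJz a (size l + (size c).+2) :: c) ++ IJmp (size l) :: r.
  by rewrite -EP cat_rcons -catA.
by rewrite /step nth_mid.
Qed.

(** * The unranking program *)

(* Register use: 0: n; 1: remaining rank; 2, 3, 4: scratch; 5: W = 2 ^ beta;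
   6: the constant 1; 7: base n + 26 of the table, whose cell k * W + w holds
   [completions k w]; 8: loop counter; 9: table index; 10: history;
   11: weight threshold; 12: n + 13.  The output cells 2, ..., 12 are registers,
   so their contents are kept n + 13 cells further and copied at the very end,
   when only cells 0 and 1 are needed. *)
Definition setup (beta p : nat) : seq instr :=
  [:: IConst 6 1; IBin OSub 1 1 6; IConst 5 (2 ^ beta); IConst 2 13;
      IBin OAdd 12 0 2; IBin OAdd 7 12 2; IConst 2 beta; IBin OLt 3 0 2;
      IBin OMul 3 3 2; IConst 2 p.+1; IBin OAdd 11 2 3; IBin OMul 8 0 5;
      IConst 9 0].

(** Row 0 of the table is unrolled over all histories, with their weights as program constants; this
    is legitimate because beta is fixed. *)
Definition fill_entry (beta w : nat) : seq instr :=
  [:: IConst 2 w; IBin OAdd 4 7 2; IConst 2 (popcount beta w);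
      IBin OLt 2 2 11; IStore 4 2].

Definition fill (beta w c : nat) : seq instr :=
  flatten [seq fill_entry beta i | i <- iota w c].

(** With j = k * W + w in register 9, cell j + W is computed from cell w of row 0, which holds
    [light w], and from the two successors of w in row k. *)
Definition table_body : seq instr :=
  [:: IBin OMod 2 9 5; IBin OSub 3 9 2; IBin OAdd 3 3 7; IBin OAdd 2 2 7;
      ILoad 2 2; IBin OAdd 4 9 9; IBin OMod 4 4 5; IBin OAdd 3 3 4; ILoad 4 3;
      IBin OAdd 3 3 6; ILoad 3 3; IBin OAdd 4 4 3; IBin OMul 4 2 4;
      IBin OAdd 3 9 5; IBin OAdd 3 3 7; IBin OAdd 9 9 6; IBin OSub 8 8 6;
      IStore 3 4].

Definition restart : seq instr :=
  [:: IConst 2 0; IBin OAdd 8 0 2; IConst 10 0].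

(** Branch-free: the output address is displaced by a comparison times n + 13, and the new bit 1 -
    [r < a] multiplies the amount subtracted from the rank. *)
Definition unrank_body : seq instr :=
  [:: IBin OSub 2 0 8; IBin OAdd 2 2 6; IBin OAdd 2 2 6; IConst 3 13;
      IBin OLt 3 2 3; IBin OMul 3 3 12; IBin OAdd 2 2 3; IBin OSub 8 8 6;
      IBin OMul 3 8 5; IBin OAdd 3 3 7; IBin OAdd 10 10 10; IBin OMod 10 10 5;
      IBin OAdd 3 3 10; ILoad 3 3; IBin OLt 4 1 3; IBin OSub 4 6 4;
      IBin OMul 3 3 4; IBin OSub 1 1 3; IBin OAdd 10 10 4; IStore 2 4].

(** Register 0 becomes the source pointer n + 15, where the first displaced bit lies, and register 1
    its increment. *)
Definition rewind : seq instr := [:: IConst 0 2; IBin OAdd 0 0 12; IConst 1 1].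

Definition copy (d c : nat) : seq instr :=
  flatten [seq [:: ILoad i 0; IBin OAdd 0 0 1] | i <- iota d c].

(** A bundle of rewrite rules, in both orientations, that resolves every [upd] test between a
    register and a data cell. *)
Definition not_register x : Type :=
  (((x == 0) = false) * ((x == 1) = false) * ((x == 2) = false) * ((x == 3)
   = false) * ((x == 4) = false) * ((x == 5) = false) * ((x == 6) = false) *
   ((x == 7) = false) * ((x == 8) = false) * ((x == 9) = false) * ((x == 10)
   = false) * ((x == 11) = false) * ((x == 12) = false) * ((0 == x) = false)
   * ((1 == x) = false) * ((2 == x) = false) * ((3 == x) = false) * ((4 == x)
   = false) * ((5 == x) = false) * ((6 == x) = false) * ((7 == x) = false) *
   ((8 == x) = false) * ((9 == x) = false) * ((10 == x) = false) * ((11 == x)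
   = false) * ((12 == x) = false))%type.

Lemma far x : 13 <= x -> not_register x.
Proof. by move=> Hx; do !split; apply/eqP; lia. Qed.

(** * Invariants and correctness of the blocks *)

Section Correctness.

Variables (beta p n r0 : nat).
Hypothesis beta_gt0 : 0 < beta.

Let W := 2 ^ beta.
Let q := p.+1 + (n < beta) * beta.
(** Displaced output bits use cells n + 15 to n + 25 and the others stop at n + 1, so the table can
    start at n + 26. *)
Let tb := n + 26.
Let B := n + 26 + n.+1 * W.

Let W_gt0 : 0 < W. Proof. by rewrite expn_gt0. Qed.

Let tb_far x : 13 <= tb + x. Proof. by rewrite /tb; lia. Qed.

Let tb_lt k : k < n.+1 * W -> tb + k < B. Proof. by rewrite /B ltn_add2l. Qed.

Definition consts (m : memory) :=
  [/\ m 0 = n, m 5 = W, m 6 = 1, m 7 = tb & m 12 = n + 13].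

Definition table (N : nat) (m : memory) :=
  forall j, j < N -> m (tb + j) = completions beta q (j %/ W) (j %% W).

Definition fill_inv (w : nat) (m : memory) :=
  [/\ consts m, m 1 = r0, m 8 = n * W & m 9 = 0 ] /\ m 11 = q /\
  (w <= W -> table w m).

Lemma setup_wp :
  wp B (setup beta p) (fill_inv 0) (rmem (init_state n r0.+1)).
Proof.
rewrite /setup /= => v1 E1 v2 E2 v3 E3 v4 E4 v5 E5 v6 E6 v7 E7.
rewrite /upd /= in E1 E2 E3 E4 E5 E6 E7.
rewrite /fill_inv /consts /upd /= /tb /q; do !split=> //; lia.
Qed.

Lemma fill_wp w c Q m : w + c <= W ->
  fill_inv w m -> (forall m', fill_inv (w + c) m' -> Q m') -> wp B (fill beta w c) Q m.
Proof.
elim: c w m => [|c IH] w m /= Hw Hm HQ.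
  by apply: HQ; rewrite addn0.
move=> v1 E1 v2 E2; rewrite /upd /= in E1 E2.
case: Hm => -[[m0 m5 m6 m7 m12] m1 m8 m9] [m11 Ht].
split; first by rewrite /upd /= E1 m7 /tb /B; nia.
move=> x v Ex Ev; rewrite /upd /= in Ex Ev.
apply: (IH w.+1); first by lia.
  have Hx : 13 <= x by rewrite Ex E1 m7 /tb; lia.
  rewrite /fill_inv /consts /table /upd /= !(far Hx); do !split=> //.
  move=> Hw' j Hj; case: (tb + j =P x) => Hjx.
    have -> : j = w by lia.
    rewrite Ev E2 m11 divn_small ?modn_small //.
  by rewrite !(far (tb_far j)) Ht //; lia.
by rewrite addSnnS.
Qed.

Lemma completions_index k w : w < W ->
  completions beta q ((k * W + w) %/ W) ((k * W + w) %% W) = completions beta q k w.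
Proof. by move=> Hw; rewrite divnMDl // modnMDl divn_small // modn_small // addn0. Qed.

(** The recurrence in terms of table indices. The two successors of w are the consecutive numbers 2w
    mod W and 2w mod W + 1, so their cells are adjacent; the first factor is the row 0 entry
    [light w]. *)
Lemma completions_next j (w := j %% W) (a := j %/ W * W) :
  completions beta q ((j + W) %/ W) ((j + W) %% W) =
  completions beta q (w %/ W) (w %% W) *
    (completions beta q ((a + (w + w) %% W) %/ W) ((a + (w + w) %% W) %% W)
     + completions beta q ((a + (w + w) %% W).+1 %/ W) ((a + (w + w) %% W).+1 %% W)).
Proof.
have Hw : w < W by rewrite ltn_pmod.
have Hp (b : bool) : (w + w) %% W + b < W by exact (push_lt w b beta_gt0).
rewrite -addnS divnDr // divnn W_gt0 addn1 modnDr /= -/W -/w -[(_ %% W).+1]addn1.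
rewrite (divn_small Hw) (modn_small Hw) !completions_index ?(Hp true) //.
  by rewrite /push /= addn0.
by have := Hp false; rewrite addn0.
Qed.

Definition table_inv (rem : nat) (m : memory) :=
  [/\ consts m, m 1 = r0, m 8 = rem, rem <= n * W & m 9 = n * W - rem] /\
  table (n * W - rem + W) m.

Lemma table_wp rem m : table_inv rem.+1 m -> wp B table_body (table_inv rem) m.
Proof.
case=> -[[m0 m5 m6 m7 m12] m1 m8 Hrem m9] Ht.
set j := n * W - rem.+1 in m9 Ht.
have Ej : n * W - rem = j.+1 by rewrite /j; lia.
have Hj : j < n * W by rewrite /j; lia.
pose w := j %% W; pose a := j %/ W * W.
have Ew : j = a + w by rewrite /a /w -divn_eq.
have Hw : w < W by rewrite ltn_pmod.
have Hw1 : (w + w) %% W + 1 < W by exact (push_lt w true beta_gt0).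
(* The program doubles j itself: the row offset a vanishes modulo W. *)
have Eww : (j + j) %% W = (w + w) %% W by rewrite modnDm.
(* The three cells read lie in the part of the table already filled. *)
have lt_w : w < j + W by rewrite ltn_addl.
have lt_0 : a + (w + w) %% W < j + W by clear Eww; lia.
have lt_1 : a + ((w + w) %% W + 1) < j + W by clear Eww; lia.
have lt_j : j + W < n.+1 * W by clear -Hj; rewrite mulSn; lia.
rewrite /table_body /=.
move=> v1 E1 v2 E2 v3 E3 v4 E4; rewrite /upd /= in E1 E2 E3 E4.
rewrite m9 m5 -/w in E1; rewrite m9 E1 Ew addnK in E2.
rewrite m7 E2 addnC in E3; rewrite m7 E1 addnC in E4.
split; first by rewrite /upd /= E4 tb_lt // (ltn_trans lt_w).
move=> v5 E5 v6 E6 v7 E7 v8 E8; rewrite /upd /= in E5 E6 E7 E8.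
have H4 : 13 <= v4 by rewrite E4.
rewrite !(far H4) E4 Ht in E5; last exact: lt_w.
rewrite m9 in E6; rewrite m5 E6 Eww in E7; rewrite E3 E7 in E8.
split; first by rewrite /upd /= E8 -addnA tb_lt // (ltn_trans lt_0).
move=> v9 E9 v10 E10; rewrite /upd /= in E9 E10.
have H8 : 13 <= v8 by rewrite E8 -addnA.
rewrite !(far H8) E8 -addnA Ht in E9; last exact: lt_0.
rewrite m6 E8 -2!addnA in E10.
split; first by rewrite /upd /= E10 tb_lt // (ltn_trans lt_1).
move=> v11 E11 v12 E12 v13 E13 v14 E14 v15 E15 v16 E16 v17 E17.
rewrite /upd /= in E11 E12 E13 E14 E15 E16 E17.
have H10 : 13 <= v10 by rewrite E10.
rewrite !(far H10) E10 Ht in E11; last exact: lt_1.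
rewrite m9 m5 in E14; rewrite E14 m7 addnC in E15; rewrite m9 m6 in E16; rewrite m8 m6 in E17.
split; first by rewrite /upd /= E15 tb_lt.
move=> x v Ex Ev; rewrite /upd /= in Ex Ev.
have Hx : 13 <= x by rewrite Ex E15.
rewrite /table_inv /consts /table /upd /= !(far Hx).
split; first by split=> //; clear -Hrem Ej E16 E17; lia.
move=> i; rewrite Ej addSn ltnS => Hi; case: (tb + i =P x) => Hix.
  have -> : i = j + W by clear -Hix Ex E15; lia.
  by rewrite completions_next Ev E13 E12 E11 E9 E5 [RHS]mulnC mulnC addn1 addnS.
rewrite !(far (tb_far i)) Ht // ltn_neqAle Hi andbT.
by apply/eqP => Hij; apply: Hix; rewrite Ex E15 Hij.
Qed.

(* Address where bit i is kept while cells below 13 serve as registers. *)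
Definition slot i := i.+2 + (i.+2 < 13) * (n + 13).

Lemma slot_ge i : 13 <= slot i.
Proof. by rewrite /slot; lia. Qed.

Lemma slot_lt i : i < n -> slot i < tb.
Proof. by rewrite /slot /tb; lia. Qed.

(** Displaced addresses exceed n + 13, while the others are at most n + 1. *)
Lemma slot_inj i j : i < n -> j < n -> slot i = slot j -> i = j.
Proof. by rewrite /slot; lia. Qed.

Definition written (s : seq bool) (m : memory) :=
  forall i, i < size s -> m (slot i) = nth false s i.

(** The conserved quantity is the bits already written followed by the unranking of the current
    state: it is always the final answer. *)
Definition unrank_inv (rem : nat) (m : memory) :=
  [/\ consts m, m 8 = rem, rem <= n, m 10 < W & table (n.+1 * W) m] /\
  exists s, [/\ size s = n - rem,
    s ++ unrank beta q rem (m 10) (m 1) = unrank beta q n 0 r0 & written s m].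

Lemma restart_wp m : table_inv 0 m -> wp B restart (unrank_inv n) m.
Proof.
case=> -[[m0 m5 m6 m7 m12] m1 m8 _ m9]; rewrite subn0 addnC -mulSn => Ht.
rewrite /restart /= => v E; rewrite /upd /= in E.
split; first split.
- by [].
- by rewrite /upd /= E m0 addn0.
- by [].
- by [].
- by move=> j Hj; rewrite /upd /= !(far (tb_far j)) Ht.
by exists [::]; rewrite subnn /upd /= m1; split.
Qed.

Lemma unrank_wp rem m : unrank_inv rem.+1 m -> wp B unrank_body (unrank_inv rem) m.
Proof.
case=> -[[m0 m5 m6 m7 m12] m8 Hrem Hw Ht] [s [Hs Es Hm]].
set w := m 10 in Hw Es; set r := m 1 in Es.
pose i := n - rem.+1.
have Ei : n - rem = i.+1 by rewrite /i; lia.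
have Hi : i < n by rewrite /i; lia.
have Hw0 : (w + w) %% W < W by rewrite ltn_pmod.
have lt_t : rem * W + (w + w) %% W < n.+1 * W.
  apply: (@leq_trans (rem.+1 * W)); first by rewrite mulSnr ltn_add2l.
  by rewrite leq_mul2r ltnS (ltnW Hrem) orbT.
pose a := completions beta q rem (push W w false).
have Ea : a = completions beta q rem ((w + w) %% W) by rewrite /a /push addn0.
rewrite /unrank_body /=.
move=> v1 E1 v2 E2 v3 E3 v4 E4 v5 E5 v6 E6; rewrite /upd /= in E1 E2 E3 E4 E5 E6.
rewrite m0 m8 -/i in E1; rewrite E1 m6 addn1 in E2; rewrite E2 m6 addn1 in E3.
rewrite E3 in E4; rewrite E4 m12 in E5; rewrite E3 E5 -/(slot i) in E6.
move=> v7 E7 v8 E8 v9 E9 v10 E10 v11 E11 v12 E12.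
rewrite /upd /= in E7 E8 E9 E10 E11 E12.
rewrite m8 m6 subn1 /= in E7; rewrite E7 m5 in E8; rewrite E8 m7 addnC in E9.
rewrite -/w in E10; rewrite E10 m5 in E11; rewrite E9 E11 -addnA in E12.
split; first by rewrite /upd /= E12 tb_lt.
move=> v13 E13 v14 E14 v15 E15 v16 E16 v17 E17 v18 E18.
rewrite /upd /= in E13 E14 E15 E16 E17 E18.
have H12 : 13 <= v12 by rewrite E12.
rewrite !(far H12) E12 Ht in E13; last exact: lt_t.
rewrite (completions_index _ Hw0) -Ea in E13.
rewrite -/r in E14.
have {}E15 : v15 = (a <= r) by rewrite E15 E14 E13 m6 [a <= r]leqNgt; case: (r < a).
rewrite E13 E15 in E16; rewrite -/r E16 in E17; rewrite E11 E15 in E18.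
have Hslot : slot i < B.
  by rewrite (ltn_trans (slot_lt Hi)) // -[tb]addn0 tb_lt // muln_gt0 W_gt0.
split; first by rewrite /upd /= E6.
move=> x v Ex Ev; rewrite /upd /= in Ex Ev.
have {}Ex : x = slot i by rewrite Ex.
have Hx : 13 <= x by rewrite Ex slot_ge.
split; first split.
- by rewrite /consts /upd /= !(far Hx).
- by rewrite /upd /= !(far Hx).
- exact: ltnW.
- by rewrite /upd /= !(far Hx) E18; apply: (push_lt w (a <= r)).
(* The bit is stored below the table base, so the table survives. *)
- move=> j Hj; rewrite /upd /= !(far (tb_far j)).
  case: (tb + j =P x) => Hjx; last by rewrite Ht.
  by have := slot_lt Hi; rewrite -Ex -Hjx ltnNge leq_addr.
exists (rcons s (a <= r)); split.
- by rewrite size_rcons Hs Ei.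
- by rewrite -Es cat_rcons /upd /= !(far Hx) E17 E18.
set m' := upd _ x v.
have Em' y : 13 <= y -> m' y = if y == x then v else m y.
  by move=> Hy; rewrite /m' /upd /= !(far Hy).
move=> k; rewrite size_rcons Hs -/i ltnS => Hk; rewrite (Em' _ (slot_ge k)) nth_rcons Hs -/i.
case: (slot k =P x) => Hkx.
  have -> : k = i by apply: slot_inj => //; [exact: leq_ltn_trans Hk Hi | rewrite Hkx].
  by rewrite ltnn eqxx Ev E15.
have ki : k < i.
  by rewrite ltn_neqAle Hk andbT; apply/eqP => Eki; apply: Hkx; rewrite Eki.
by rewrite ki Hm // Hs.
Qed.

(** Sources lie beyond all destinations, so none is overwritten before being read, and 1 < d
    protects the pointer and its increment. *)
Lemma copy_wp d c src Q m : 1 < d -> d + c <= src -> src + c <= B ->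
  m 0 = src -> m 1 = 1 ->
  (forall m', (forall y, 1 < y -> m' y = if d <= y < d + c then m (src + (y - d)) else m y) ->
     Q m') ->
  wp B (copy d c) Q m.
Proof.
elim: c d src m => [|c IH] d src m d1 Hsrc HB m0 m1 HQ /=.
  by apply: HQ => y _; case: ifP => //; lia.
rewrite m0; split=> [|v E v' E']; first by lia.
have [Hd0 Hd1] : (0 == d = false) /\ (1 == d = false) by split; apply/eqP; lia.
rewrite /upd /= Hd0 Hd1 m0 m1 in E'.
apply: (IH d.+1 src.+1); [lia|lia|lia| | |].
- by rewrite /upd /= E' addn1.
- by rewrite /upd /= Hd1.
move=> m' Hm'; apply: HQ => y Hy; rewrite Hm' // /upd.
have y0 : (y == 0) = false by apply/eqP; lia.
case: ifP => Hyc.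
  have -> : d <= y < d + c.+1 by lia.
  have -> : src.+1 + (y - d.+1) = src + (y - d) by lia.
  rewrite /=.
  by have -> : (src + (y - d) == d) = false by apply/eqP; lia.
rewrite y0; case: (y =P d) => Hyd; last by case: ifP => //; lia.
by rewrite Hyd leqnn subnn addn0 E; case: ifP => //; lia.
Qed.

Lemma finish_wp m : unrank_inv 0 m ->
  wp B (rewind ++ copy 2 11)
     (fun m' => forall k, k < n -> m' (2 + k) = nth false (unrank beta q n 0 r0) k) m.
Proof.
case=> -[[m0 m5 m6 m7 m12] m8 _ Hw _] [s [Hs Es Hm]].
rewrite cats0 subn0 in Es Hs; rewrite -Es.
apply: wp_cat; set Q := wp B (copy 2 11) _; rewrite /= {}/Q => v E; rewrite /upd /= in E.
apply: (@copy_wp 2 11 v) => //.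
- by rewrite E m12; lia.
- by rewrite E m12 /B; lia.
move=> m' Hm' k Hk; rewrite Hm' // -Hm ?Hs // /slot.
(* Bits with index below 11 come from their displaced cells; the later ones were written in
   place. *)
case: ifP => Hk11.
  have -> : k.+2 < 13 by lia.
  have -> : v + (2 + k - 2) = k.+2 + true * (n + 13) by rewrite E m12; lia.
  have Hf : 13 <= k.+2 + true * (n + 13) by lia.
  by rewrite /upd !(far Hf).
have -> : (k.+2 < 13) = false by lia.
have Hf : 13 <= k.+2 by lia.
by rewrite addn0 add2n /upd !(far Hf).
Qed.

End Correctness.

(** * Assembling the program and counting steps *)

Definition table_pre (beta p : nat) := setup beta p ++ fill beta 0 (2 ^ beta).

Definition unrank_pre (beta p : nat) :=
  table_pre beta p ++ loop (size (table_pre beta p)) 8 table_body ++ restart.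

Definition program (beta p : nat) :=
  unrank_pre beta p ++ loop (size (unrank_pre beta p)) 8 unrank_body ++
  rewind ++ copy 2 11.

Lemma fill_regs beta w c : all (regs_below 13) (fill beta w c).
Proof. by rewrite /fill; elim: c w => //= c IH w; rewrite IH. Qed.

Lemma size_fill beta w c : size (fill beta w c) = 5 * c.
Proof. by rewrite /fill; elim: c w => //= c IH w; rewrite IH mulnS. Qed.

(** The constant 43 is 13 for [setup], 3 for [restart], 25 for the final copy with its rewind, and
    one exit test for each of the two loops. *)
Lemma program_run beta p n r0 (W := 2 ^ beta) (B := n + 26 + n.+1 * W) :
  0 < beta -> exists2 m' : memory,
    (forall k, k < n ->
       m' (2 + k) = nth false (unrank beta (p.+1 + (n < beta) * beta) n 0 r0) k) &
    reaches (program beta p) B (43 + 5 * W + n * W * 20 + n * 22)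
      0 (rmem (init_state n r0.+1)) (size (program beta p)) m'.
Proof.
move=> b0; have KB : 13 <= B by rewrite /B; lia.
set P := program beta p; set p1 := table_pre beta p; set p2 := unrank_pre beta p.
have regs1 : all (regs_below 13) p1 by rewrite all_cat fill_regs.
have wp1 : wp B p1 (table_inv beta p n r0 (n * W)) (rmem (init_state n r0.+1)).
  apply: wp_cat; apply: wp_mono; last exact: (@setup_wp beta p n r0 b0).
  move=> m Hm.
  apply: (fill_wp b0 _ Hm) => [|m' [[H1 H2 H3 H4] [_ H5]]]; first by rewrite add0n.
  by split; [split=> //; rewrite H4 subnn | rewrite subnn; apply: H5].
pose l1 := loop (size p1) 8 table_body; pose l2 := loop (size p2) 8 unrank_body.
pose fin := rewind ++ copy 2 11.
have [m1 I1 R1] := @reaches_block B 13 [::] p1 (l1 ++ restart ++ l2 ++ fin) _ _ KB regs1 wp1.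
have [m2 I2 R2] := @reaches_loop B 13 p1 8 table_body (restart ++ l2 ++ fin)
  (table_inv beta p n r0) (n * W) m1 KB isT isT
  (fun _ _ H => let: conj (And5 _ _ e _ _) _ := H in e)
  (fun i m _ H => @table_wp beta p n r0 b0 i m H) I1.
have [m3 I3 R3] := @reaches_block B 13 (p1 ++ l1) restart (l2 ++ fin) _ _ KB isT (@restart_wp beta p n r0 b0 m2 I2).
have [m4 I4 R4] := @reaches_loop B 13 p2 8 unrank_body fin
  (unrank_inv beta p n r0) n m3 KB isT isT
  (fun _ _ H => let: conj (And5 _ e _ _ _) _ := H in e)
  (fun i m _ H => @unrank_wp beta p n r0 b0 i m H) I3.
have [m5 I5 R5] := @reaches_block B 13 (p2 ++ l2) fin [::] _ _ KB isT (@finish_wp beta p n r0 b0 m4 I4).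
exists m5 => //.
have EP : P = p2 ++ l2 ++ fin by [].
have EP1 : P = p1 ++ l1 ++ restart ++ l2 ++ fin by rewrite EP /p2 /unrank_pre -!catA.
have EP2 : P = (p1 ++ l1) ++ restart ++ l2 ++ fin by rewrite EP1 -!catA.
have EP3 : P = (p2 ++ l2) ++ fin ++ [::] by rewrite EP cats0 -!catA.
have Ep2 : size (p1 ++ l1) + size restart = size p2.
  by rewrite /p2 /unrank_pre !size_cat addnA.
have EsP : size (p2 ++ l2) + size fin = size P by rewrite EP catA [RHS]size_cat.
rewrite cat0s -EP1 in R1; rewrite -/l1 -size_cat -EP1 in R2.
rewrite -EP2 Ep2 in R3; rewrite -/l2 -size_cat -EP in R4; rewrite -EP3 EsP in R5.
have <- : size p1 + ((n * W * (size table_body).+2).+1 +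
    (size restart + ((n * (size unrank_body).+2).+1 + size fin))) =
    43 + 5 * W + n * W * 20 + n * 22.
  by rewrite size_cat size_fill -/W /=; lia.
exact (reaches_trans R1 (reaches_trans R2 (reaches_trans R3 (reaches_trans R4 R5)))).
Qed.

(* For fixed beta, p there is a RAM program P and a constant C such that for
   every n >= 1 and every 1 <= m <= M_n, P on input (n, m) halts within C*n
   steps using at most C*n memory cells, leaving in cells 2, ..., n+1 the
   entries c_1, ..., c_n of the c in S_n(beta,p) with ord(c) = m. *)
Theorem theorem10 (beta p : nat) : 0 < beta -> 0 < p ->
  exists (P : seq instr) (C : nat),
    forall n m : nat, 0 < n -> 0 < m -> m <= Mn beta p n ->
      exists (t : nat) (sf : state),
        [/\ halts_in P (init_state n m) t sf,
            t <= C * n,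
            hw sf <= C * n &
            exists c : n.-tuple bool,
              [/\ c \in Sn beta p n,
                  ord beta p c = m &
                  forall k : 'I_n, rmem sf (2 + k) = nat_of_bool (tnth c k)]].
Proof.
(* For n >= 1 the time is at most (65 + 25 * 2^beta) * n and the space at most (27 + 2 * 2^beta) *
   n; the constant generously covers both. *)
move=> b0 _; exists (program beta p), (100 + 30 * 2 ^ beta) => n m n0 m0 Hm.
have [c [Hc Ho Ec]] := unrank_ord b0 m0 Hm.
have [m' Hm' R] := @program_run beta p n m.-1 b0.
have [|h Hh E] := R 2; first by lia.
set W := 2 ^ beta in Hh E *.
exists (43 + 5 * W + n * W * 20 + n * 22), (mkState (size (program beta p)) m' h); split.
- split; first by rewrite -[in init_state _ _](prednK m0).
  (* Past its end the program reads the default instruction [IHalt]. *)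
  by rewrite /step nth_default.
- by clear -n0; nia.
- by apply: leq_trans Hh _; clear -n0; nia.
exists c; split; [exact: Hc | exact: Ho | move=> k].
by rewrite (tnth_nth false) Ec -Hm' ?ltn_ord.
Qed.
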